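(* Let $\mathcal G=(V,\mathcal E)$ be a temporal graph, $n=|V|$, and let $(\star)$ be one of the optimality criteria shortest, shortest-foremost, prefix-foremost. Let $(s,z)$ be drawn uniformly at random from $\{(s,z)\in V\times V:s\ne z\}$, and for $v\in V$ let $\widetilde b^{(\star)}(v\mid s,z)=\sigma^{(\star)}_{sz}(v)/\sigma^{(\star)}_{sz}$. Then $\widetilde b^{(\star)}(v\mid s,z)$ is an unbiased estimator of the $(\star)$-temporal betweenness centrality: $\mathbf E[\widetilde b^{(\star)}(v\mid s,z)]=\mathtt b^{(\star)}_v$ for every $v\in V$.
   Context: A (directed) temporal graph is $\mathcal G=(V,\mathcal E)$ with $V$ finite, $n=|V|\ge2$, and $\mathcal E$ a finite set of temporal edges $(u,v,t)$, $u,v\in V$, $t\in T=\{1,\dots,|T|\}$. A temporal path from $s$ to $z\ne s$ is a sequence $((u_1,t_1),\dots,(u_k,t_k))$ with $u_1=s$, $u_k=z$, $t_1=0$, $t_i<t_{i+1}$ and $(u_i,u_{i+1},t_{i+1})\in\mathcal E$. Its length is $k-1$, its arrival time $t_k$; it is foremost if no temporal path from $s$ to $z$ arrives earlier (the trivial path from $s$ to itself arrives at time $0$). $(\star)$-optimal means: shortest (minimum length), shortest-foremost (minimum length among foremost paths), or prefix-foremost (foremost with every prefix foremost). $\sigma^{(\star)}_{sz}$ is the number of $(\star)$-optimal temporal paths from $s$ to $z$ and $\sigma^{(\star)}_{sz}(v)$ the number of those passing through $v$ for $v\notin\{s,z\}$, with $\sigma^{(\star)}_{sz}(v)=0$ if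 $v\in\{s,z\}$; the ratio $\sigma^{(\star)}_{sz}(v)/\sigma^{(\star)}_{sz}$ is $0$ if $\sigma^{(\star)}_{sz}=0$. The $(\star)$-temporal betweenness is $\mathtt b^{(\star)}_v=\frac1{n(n-1)}\sum_{s\ne v\ne z,\ s\ne z}\sigma^{(\star)}_{sz}(v)/\sigma^{(\star)}_{sz}$. *)

(* Defs.v *)
From HB Require Import structures.
From mathcomp Require Import all_boot all_order all_algebra.
From mathcomp Require Import all_classical all_reals all_analysis.

Set Implicit Arguments.
Unset Strict Implicit.
Unset Printing Implicit Defensive.

Import Order.TTheory GRing.Theory Num.Theory.

Local Open Scope ring_scope.

(* Time steps are 1, ..., tau; the ordinal type also contains the time 0,
   which is the time of the first entry of a temporal path, and the second
   field keeps it from being the time of an edge. *)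
Record temporal_graph (V : finType) (tau : nat) := TemporalGraph {
  tedges : {set V * V * 'I_tau.+1};
  tedges_gt0 : forall e, e \in tedges -> (0 < e.2)%N
}.

Definition tstep (V : finType) (tau : nat) (G : temporal_graph V tau) :
    rel (V * 'I_tau.+1) :=
  fun x y => (x.2 < y.2)%N && ((x.1, y.1, y.2) \in tedges G).

(* For z = s this also accepts the trivial path [:: (s, ord0)], which is the
   one that makes every nontrivial return to s fail to be foremost. *)
Definition is_tpath (V : finType) (tau : nat) (G : temporal_graph V tau)
    (s z : V) (p : seq (V * 'I_tau.+1)) : bool :=
  if p is x :: p' then
    [&& x == (s, ord0), path (tstep G) x p' & (last x p').1 == z]
  else false.

Definition tlength (V : finType) (tau : nat) (p : seq (V * 'I_tau.+1)) : nat :=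
  (size p).-1.

Definition arrival (V : finType) (tau : nat) (p : seq (V * 'I_tau.+1)) :
    'I_tau.+1 :=
  last ord0 [seq x.2 | x <- p].

(* A finite type containing every temporal path, by size_tpath below. *)
Definition tseq (V : finType) (tau : nat) : finType :=
  {bseq tau.+1 of V * 'I_tau.+1}.

Lemma size_tpath (V : finType) (tau : nat) (G : temporal_graph V tau)
    (s z : V) (p : seq (V * 'I_tau.+1)) :
  is_tpath G s z p -> (size p <= tau.+1)%N.
Proof.
case: p => [//|x p] /and3P[_ xp _] /=; rewrite ltnS.
have bound : forall (q : seq (V * 'I_tau.+1)) (y : V * 'I_tau.+1),
    path (tstep G) y q -> (y.2 + size q <= tau)%N.
  elim=> [|w q IH] y /=; first by rewrite addn0 -ltnS ltn_ord.
  move=> /andP[/andP[yw _] /IH]; apply: leq_trans.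
  by rewrite addnS -addSn leq_add2r.
by apply: leq_trans (bound p x xp); rewrite leq_addl.
Qed.

Definition shortest (V : finType) (tau : nat) (G : temporal_graph V tau)
    (s z : V) (p : seq (V * 'I_tau.+1)) : bool :=
  is_tpath G s z p &&
  [forall q : tseq V tau, is_tpath G s z q ==> (tlength p <= tlength q)%N].

Definition foremost (V : finType) (tau : nat) (G : temporal_graph V tau)
    (s z : V) (p : seq (V * 'I_tau.+1)) : bool :=
  is_tpath G s z p &&
  [forall q : tseq V tau, is_tpath G s z q ==> (arrival p <= arrival q)%N].

Definition shortest_foremost (V : finType) (tau : nat)
    (G : temporal_graph V tau) (s z : V) (p : seq (V * 'I_tau.+1)) : bool :=
  foremost G s z p &&
  [forall q : tseq V tau, foremost G s z q ==> (tlength p <= tlength q)%N].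

Definition prefix_foremost (V : finType) (tau : nat)
    (G : temporal_graph V tau) (s z : V) (p : seq (V * 'I_tau.+1)) : bool :=
  foremost G s z p &&
  [forall q : tseq V tau, (0 < size q)%N && prefix q p ==>
     foremost G s (last s [seq x.1 | x <- q]) q].

Inductive criterion := Shortest | ShortestForemost | PrefixForemost.

Definition optimal (c : criterion) (V : finType) (tau : nat)
    (G : temporal_graph V tau) (s z : V) (p : seq (V * 'I_tau.+1)) : bool :=
  match c with
  | Shortest => shortest G s z p
  | ShortestForemost => shortest_foremost G s z p
  | PrefixForemost => prefix_foremost G s z p
  end.

Definition sigma (c : criterion) (V : finType) (tau : nat)
    (G : temporal_graph V tau) (s z : V) : nat :=
  #|[set p : tseq V tau | optimal c G s z p]|.

Definition sigma_through (c : criterion) (V : finType) (tau : nat)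
    (G : temporal_graph V tau) (s z v : V) : nat :=
  if (v == s) || (v == z) then 0%N
  else #|[set p : tseq V tau |
           optimal c G s z p && (v \in [seq x.1 | x <- p])]|.

(* The value is 0 when no path is optimal, since 0^-1 = 0. *)
Definition btilde (R : realType) (c : criterion) (V : finType) (tau : nat)
    (G : temporal_graph V tau) (v s z : V) : R :=
  (sigma_through c G s z v)%:R / (sigma c G s z)%:R.

Definition betweenness (R : realType) (c : criterion) (V : finType)
    (tau : nat) (G : temporal_graph V tau) (v : V) : R :=
  (#|V| * (#|V| - 1))%:R^-1 *
  \sum_(sz : V * V | [&& sz.1 != v, v != sz.2 & sz.1 != sz.2])
    (sigma_through c G sz.1 sz.2 v)%:R / (sigma c G sz.1 sz.2)%:R.

(* S carries the discrete sigma-algebra: measurability of X and its law are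
   given on singletons, which is enough as S is finite. *)
Definition uniform_draw (R : realType) (d : measure_display)
    (Omega : measurableType d) (P : probability Omega R) (S : finType)
    (A : {set S}) (X : Omega -> S) : Prop :=
  forall x : S,
    measurable (X @^-1` [set x])%classic /\
    P (X @^-1` [set x])%classic = (if x \in A then #|A|%:R^-1 else 0)%:E.

(* Main.v *)
Require Import Defs.
From HB Require Import structures.
From mathcomp Require Import all_boot all_order all_algebra.
From mathcomp Require Import all_classical all_reals all_analysis.

Set Implicit Arguments.
Unset Strict Implicit.
Unset Printing Implicit Defensive.

Import Order.TTheory GRing.Theory Num.Theory.

Local Open Scope ring_scope.

(** The expectation of a function of a uniform draw from a finite set is its average over that set
    ([expectation_uniform_draw]). Here the set is the off-diagonal of [V * V], of size n(n-1)
    ([card_offdiag]), which is the normalisation in [betweenness]. The average also runs over pairs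
    having [v] as an endpoint, which [betweenness] leaves out, but there [sigma_through] is 0, so
    the two sums agree. *)

Lemma card_offdiag (T : finType) :
  #|[set xy : T * T | xy.1 != xy.2]| = (#|T| * (#|T| - 1))%N.
Proof.
have diag : #|[set xy : T * T | xy.1 == xy.2]| = #|T|.
  have pair_inj : injective (fun x : T => (x, x)) by move=> x y [].
  rewrite -(card_imset predT pair_inj); apply: eq_card => -[x y].
  rewrite inE /=; apply/eqP/imsetP => [->|[z _ [-> ->]]//].
  by exists y.
(* The square splits into diagonal and complement, so the truncated subtraction removes exactly the
   diagonal. *)
rewrite mulnBr muln1 -card_prod -(cardsC [set xy : T * T | xy.1 == xy.2]) diag.
by rewrite addKn; apply: eq_card => xy; rewrite !inE.
Qed.

(** Since [S] is finite, [f] composed with [X] is a finite combination of indicators of the fibres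
    of [X]; linearity of the integral then needs only the measure of each fibre. *)
Lemma expectation_uniform_draw (R : realType) (d : measure_display)
    (Omega : measurableType d) (P : probability Omega R) (S : finType)
    (A : {set S}) (X : Omega -> S) (f : S -> R) :
  uniform_draw P A X ->
  ('E_P[fun w => f (X w)] = (#|A|%:R^-1 * \sum_(x in A) f x)%:E)%E.
Proof.
move=> unifX.
pose B x := (X @^-1` [set x])%classic.
have mB x : measurable (B x) by case: (unifX x).
have PB x : P (B x) = (if x \in A then #|A|%:R^-1 else 0)%:E by case: (unifX x).
have decomp w : ((f (X w))%:E = \sum_(x : S) (f x)%:E * (\1_(B x) w)%:E)%E.
  rewrite (bigD1 (X w)) //= big1 => [|x xXw].
    by rewrite indicE mem_set // mule1 adde0.
  rewrite indicE memNset ?mule0 // => Xwx.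
  by rewrite -Xwx eqxx in xXw.
rewrite unlock; under eq_integral do rewrite decomp.
rewrite integral_sum //; last first.
  by move=> x; apply: integrableZl => //; exact: integrable_indic.
rewrite mulr_sumr -sumEFin [RHS]big_mkcond /=; apply: eq_bigr => x _.
rewrite integralZl //; last exact: integrable_indic.
(* Fibres over points outside [A] have probability 0 and drop out of the sum. *)
rewrite integral_indic // setIT [X in (_ * X)%E]PB; case: ifP => _; last by rewrite mule0.
by rewrite -EFinM mulrC.
Qed.

Theorem lemma5 (R : realType) (V : finType) (tau : nat)
    (G : temporal_graph V tau) (hn : (2 <= #|V|)%N) (c : criterion)
    (d : measure_display) (Omega : measurableType d)
    (P : probability Omega R) (SZ : Omega -> V * V)
    (hSZ : uniform_draw P [set sz : V * V | sz.1 != sz.2] SZ) (v : V) :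
  ('E_P[fun w => btilde R c G v (SZ w).1 (SZ w).2] = (betweenness R c G v)%:E)%E.
Proof.
rewrite (expectation_uniform_draw (fun sz => btilde R c G v sz.1 sz.2) hSZ).
rewrite card_offdiag /betweenness; congr (_ * _)%:E.
rewrite big_mkcond [RHS]big_mkcond; apply: eq_bigr => -[s z] _.
rewrite inE /= /btilde /sigma_through [s == v]eq_sym.
(* If [v] is an endpoint, the term kept only on the left has numerator 0. *)
by case: (v == s); case: (v == z); case: (s != z); rewrite //= mul0r.
Qed.
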